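(* Let $I$ be a proper nonzero integrally closed monomial ideal of $S=\mathbb{K}[x_1,\ldots,x_n]$. Then for every integer $m\geq 1$, we have $$\operatorname{reg}(I^m)\geq \operatorname{reg}(I)+\gamma(I)(m-1).$$
   Context: $\mathbb{K}$ is a field and $S=\mathbb{K}[x_1,\ldots,x_n]$ is the (standard graded) polynomial ring in $n$ variables. For a graded $S$-module $M$ with graded Betti numbers $\beta_{i,j}(M)$ (so the minimal graded free resolution of $M$ has $i$-th term $\bigoplus_j S(-j)^{\beta_{i,j}(M)}$), the Castelnuovo--Mumford regularity is $\operatorname{reg}(M)=\max\{j-i : \beta_{i,j}(M)\neq 0\}$; ideals are regarded as graded $S$-modules. For a monomial ideal $I$, $G(I)$ is its unique set of minimal monomial generators. For a monomial $u$, $\deg_{x_j}(u)$ is the exponent of $x_j$ in $u$, and $$\gamma(I):=\min\{\deg_{x_j}(u) : 1\leq j\leq n,\ u\in G(I),\ x_j \text{ divides } u\}.$$ The integral closure $\overline{I}$ of $I$ is the set of $f\in S$ satisfying an equation $f^k+c_1f^{k-1}+\cdots+c_{k-1}f+c_k=0$ with $c_i\in I^i$; $I$ is integrally closed if $I=\overline{I}$. *)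

(* Defs.v *)
From mathcomp Require Import all_boot all_order all_algebra.
From mathcomp Require Import mpoly.

Set Implicit Arguments.
Unset Strict Implicit.
Unset Printing Implicit Defensive.

Import GRing.Theory.
Local Open Scope ring_scope.

Section Ideals.

Variables (K : fieldType) (n : nat).
Local Notation S := {mpoly K[n]}.

Definition ideal_span (A : S -> Prop) (f : S) : Prop :=
  exists s : seq (S * S),
    (forall c, c \in s -> A c.2) /\ f = \sum_(c <- s) c.1 * c.2.

Definition monomial_span (A : 'X_{1..n} -> Prop) : S -> Prop :=
  ideal_span (fun f => exists2 u, A u & f = 'X_[u]).

Definition monomial_ideal (I : S -> Prop) : Prop :=
  exists A : 'X_{1..n} -> Prop, forall f, I f <-> monomial_span A f.

Definition is_proper (I : S -> Prop) : Prop := ~ I 1.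

Definition is_nonzero (I : S -> Prop) : Prop := exists2 f, I f & f != 0.

Definition ideal_mul (I J : S -> Prop) : S -> Prop :=
  ideal_span (fun h => exists f g, [/\ I f, J g & h = f * g]).

Fixpoint ideal_pow (I : S -> Prop) (m : nat) : S -> Prop :=
  if m is m'.+1 then ideal_mul I (ideal_pow I m') else fun _ => True.

Definition integral_closure (I : S -> Prop) (f : S) : Prop :=
  exists (k : nat) (c : nat -> S),
    [/\ (0 < k)%N,
        forall i, (1 <= i <= k)%N -> ideal_pow I i (c i)
      & f ^+ k + \sum_(1 <= i < k.+1) c i * f ^+ (k - i) = 0].

Definition integrally_closed (I : S -> Prop) : Prop :=
  forall f, I f <-> integral_closure I f.

(* [minimal_generators I G]: G is a set of monomials generating I, and no
   proper subset of G generates I; for a monomial ideal this determines G. *)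
Definition minimal_generators (I : S -> Prop) (G : 'X_{1..n} -> Prop) : Prop :=
  (forall f, I f <-> monomial_span G f) /\
  forall G' : 'X_{1..n} -> Prop,
    (forall u, G' u -> G u) -> (forall f, I f <-> monomial_span G' f) ->
    forall u, G u -> G' u.

(* [is_gamma I g]: the minimum defining gamma(I) is attained and equals g.
   Here [u j] is the exponent of the j-th variable in the monomial u. *)
Definition is_gamma (I : S -> Prop) (g : nat) : Prop :=
  exists G : 'X_{1..n} -> Prop,
    [/\ minimal_generators I G,
        exists u j, [/\ G u, (0 < u j)%N & g = u j]
      & forall u j, G u -> (0 < u j)%N -> (g <= u j)%N].

(* A sequence of graded free modules F_i = \bigoplus_(a < rk i) S(- shift a)
   and maps ... -> F_1 -> F_0 -> S. Elements of F_i are row vectors, and maps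
   are right multiplications by matrices. Natural numbers suffice as shifts
   since ideals of S live in nonnegative degrees. *)
Record free_complex := FreeComplex {
  rk : nat -> nat;
  shift : forall i, 'I_(rk i) -> nat;
  aug : 'cV[S]_(rk 0);
  diff : forall i, 'M[S]_(rk i.+1, rk i)
}.

(* Multiplication by p is a degree-preserving map S(-a) -> S(-b). *)
Definition degree_preserving (a b : nat) (p : S) : Prop :=
  p != 0 -> (b <= a)%N /\ p \is (a - b)%N.-homog.

Definition graded_complex (F : free_complex) : Prop :=
  (forall a, degree_preserving (shift a) 0 (aug F a 0)) /\
  (forall i a b, degree_preserving (shift a) (shift b) (diff F i a b)).

(* Exactness of ... -> F_1 -> F_0 -> I -> 0. *)
Definition resolves (F : free_complex) (I : S -> Prop) : Prop :=
  [/\ forall f, I f <-> exists v : 'rV_(rk F 0), f = (v *m aug F) 0 0,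
      forall v : 'rV_(rk F 0),
        v *m aug F = 0 <-> exists w : 'rV_(rk F 1), v = w *m diff F 0
    & forall i (v : 'rV_(rk F i.+1)),
        v *m diff F i = 0 <-> exists w : 'rV_(rk F i.+2), v = w *m diff F i.+1].

(* The image of F_(i+1) lies in (x_1, ..., x_n) F_i: the entries of the
   matrices have zero constant coefficient. *)
Definition minimal_complex (F : free_complex) : Prop :=
  forall i a b, (diff F i a b)@_0%MM = 0.

Definition minimal_graded_free_resolution
    (F : free_complex) (I : S -> Prop) : Prop :=
  [/\ graded_complex F, resolves F I & minimal_complex F].

Definition betti (F : free_complex) (i j : nat) : nat :=
  #|[set a : 'I_(rk F i) | shift a == j]|.

(* [is_reg I r]: reg(I) = r, where I is regarded as a graded S-module. The
   graded Betti numbers do not depend on the choice of the resolution F. *)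
Definition is_reg (I : S -> Prop) (r : int) : Prop :=
  exists F : free_complex,
    [/\ minimal_graded_free_resolution F I,
        exists i j, betti F i j != 0%N /\ r = j%:Z - i%:Z
      & forall i j, betti F i j != 0%N -> j%:Z - i%:Z <= r].

End Ideals.

(* Main.v *)
(* Regularity is read off Koszul homology. For y_j = x_j^(k_j), the homology
   Tor_i(I, S/(y)) can be computed from a resolution F of I as H_i(F/(y)F), or
   from the Koszul complex of y as H_i(I (x) K(y)). For a monomial ideal I the
   part of the latter in multidegree c is the homology of the simplicial complex
   of the sets G with x^(c - sum_(j in G) k_j e_j) in I.

   If reg(I) = R and i is maximal with a generator e_a of F_i in degree i + R,
   then x^(N-1) e_a is a nonzero class of H_i(F/(x_1^N, ..., x_n^N)F), so that
   for some c of degree i + R + n(N-1) the complex of (I, N, c) is not acyclic.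
   If I is integrally closed, x^(mu) in I^m is equivalent to x^u in I, and this
   allows one to choose k' and c' for which the complex of (I^m, k', c') is the
   same, with c' so large that reg(I^m) >= R + gamma(I)(m-1): when the positive
   part of c - N has degree at least gamma(I), take c' = mc; otherwise no generator
   sees the exponents c_j - N >= 0, and they can be replaced by the exponents of
   x_(j0)^(m gamma(I) - 1). *)
Require Import Defs.
From mathcomp Require Import all_boot all_order all_algebra.
From mathcomp Require Import mpoly zify ring.

Set Implicit Arguments.
Unset Strict Implicit.
Unset Printing Implicit Defensive.

Import GRing.Theory Num.Theory.
Local Open Scope ring_scope.

(** * Bicomplexes with exact rows and columns *)

Section Zigzag.

Variables (D : nat -> nat -> zmodType) (P : forall p q, D p q -> Prop).
Variables (dh : forall p q, D p.+1 q -> D p q).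
Variables (dv : forall p q, D p q.+1 -> D p q).

(** [hcond] and [vcond] are the cycle conditions in the vertical and horizontal cokernel complexes.
    [P] cuts out a subgroup of each entry, later the elements of one internal degree. *)
Definition hcond p q : D p q -> Prop :=
  match p with
  | 0 => fun=> True
  | p'.+1 => fun w => exists2 v : D p' q.+1, P v & dh w = dv v
  end.

Definition vcond p q : D p q -> Prop :=
  match q with
  | 0 => fun=> True
  | q'.+1 => fun w => exists2 v : D p.+1 q', P v & dv w = dh v
  end.

(* At (i, 0) and (0, i) this is exactness of the cokernel complexes of the
   vertical, resp. horizontal, differential; the intermediate positions
   interpolate between the two. *)
Definition zexact p q :=
  forall w : D p q, P w -> hcond w -> vcond w ->
  exists (s : D p.+1 q) (t : D p q.+1), [/\ P s, P t & w = dh s + dv t].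

Hypothesis dhB : forall p q (v w : D p.+1 q), dh (v - w) = dh v - dh w.
Hypothesis dvB : forall p q (v w : D p q.+1), dv (v - w) = dv v - dv w.
Hypothesis dhh : forall p q (w : D p.+2 q), dh (dh w) = 0.
Hypothesis dvv : forall p q (w : D p q.+2), dv (dv w) = 0.
Hypothesis dhv : forall p q (w : D p.+1 q.+1), dh (dv w) = dv (dh w).
Hypothesis PB : forall p q (v w : D p q), P v -> P w -> P (v - w).
Hypothesis Ph : forall p q (w : D p.+1 q), P w -> P (dh w).
Hypothesis Pv : forall p q (w : D p q.+1), P w -> P (dv w).
Hypothesis exh : forall p q (w : D p.+1 q), P w -> dh w = 0 ->
  exists2 v, P v & w = dh v.
Hypothesis exv : forall p q (w : D p q.+1), P w -> dv w = 0 ->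
  exists2 v, P v & w = dv v.

Let dvD p q (v w : D p q.+1) : dv (v + w) = dv v + dv w.
Proof.
have dv0 : dv (0 : D p q.+1) = 0 by rewrite -(subrr 0) dvB subrr.
by rewrite -{1}[w]opprK dvB -(sub0r w) dvB dv0 sub0r opprK.
Qed.

(** A diagram chase along the antidiagonal. If [dh w = dv v], column exactness gives [hcond v], and
    [w] witnesses [vcond v]. Writing [v = dh s + dv t] makes [w - dv s] a horizontal cycle, hence a
    boundary. *)
Lemma zexact_step p q : zexact p q.+1 -> zexact p.+1 q.
Proof.
move=> zx w Pw [v Pv' dwv] _.
have hv : hcond v.
  case: p zx w Pw v Pv' dwv => [//|p] zx w Pw v Pv' dwv.
  by apply: exv; [exact: Ph | rewrite -dhv -dwv dhh].
have [s [t [Ps Pt dv_v]]] : exists (s : D p.+1 q.+1) (t : D p q.+2),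
    [/\ P s, P t & v = dh s + dv t].
  by apply: zx => //; exists w.
have dh0 : dh (w - dv s) = 0.
  by rewrite dhB dwv dhv dv_v dvD dvv addr0 subrr.
have [s' Ps' ws] := exh (PB Pw (Pv Ps)) dh0.
by exists s', s; split; rewrite // -ws subrK.
Qed.

End Zigzag.

Section ZigzagSymmetry.

Variables (D : nat -> nat -> zmodType) (P : forall p q, D p q -> Prop).
Variables (dh : forall p q, D p.+1 q -> D p q).
Variables (dv : forall p q, D p q.+1 -> D p q).
Hypothesis dhB : forall p q (v w : D p.+1 q), dh (v - w) = dh v - dh w.
Hypothesis dvB : forall p q (v w : D p q.+1), dv (v - w) = dv v - dv w.
Hypothesis dhh : forall p q (w : D p.+2 q), dh (dh w) = 0.
Hypothesis dvv : forall p q (w : D p q.+2), dv (dv w) = 0.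
Hypothesis dhv : forall p q (w : D p.+1 q.+1), dh (dv w) = dv (dh w).
Hypothesis PB : forall p q (v w : D p q), P v -> P w -> P (v - w).
Hypothesis Ph : forall p q (w : D p.+1 q), P w -> P (dh w).
Hypothesis Pv : forall p q (w : D p q.+1), P w -> P (dv w).
Hypothesis exh : forall p q (w : D p.+1 q), P w -> dh w = 0 ->
  exists2 v, P v & w = dh v.
Hypothesis exv : forall p q (w : D p q.+1), P w -> dv w = 0 ->
  exists2 v, P v & w = dv v.

Lemma zexact_tr p q : zexact P dh dv p q <->
  zexact (D := fun q p => D p q) (fun q p => @P p q)
    (fun q p => @dv p q) (fun q p => @dh p q) q p.
Proof.
by split=> zx w Pw hw vw; have [s [t [Ps Pt ->]]] := zx w Pw vw hw;
  exists t, s; split; rewrite // addrC.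
Qed.

(** Iterating [zexact_step] leads from (0, i) to (i, 0); the converse is the same walk in the
    transposed bicomplex. *)
Lemma zexact_antidiagonal i : zexact P dh dv 0 i <-> zexact P dh dv i 0.
Proof.
split.
  suff zx q p : zexact P dh dv p (q + 0) -> zexact P dh dv (q + p) 0.
    by have := @zx i 0; rewrite !addn0.
  elim: q p => // q IHq p zx; rewrite addSnnS; apply: IHq.
  exact: (zexact_step (D := D)).
suff zx q p : zexact P dh dv (q + 0) p -> zexact P dh dv 0 (q + p).
  by have := @zx i 0; rewrite !addn0.
elim: q p => // q IHq p zx; rewrite addSnnS; apply: IHq.
apply/zexact_tr; apply: (zexact_step (D := fun q p => D p q)) => //.
- by move=> p' q'; apply: PB.
- by move=> p' q'; apply: Pv.
- by move=> p' q'; apply: Ph.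
- by move=> p' q'; apply: exv.
- by move=> p' q'; apply: exh.
- exact/(zexact_tr (q.+1 + 0) p).
Qed.

End ZigzagSymmetry.

(** * Koszul complexes *)

Section Koszul.

Variables (K : fieldType) (n : nat) (k : 'I_n -> nat).
Local Notation S := {mpoly K[n]}.
Implicit Types (G : {set 'I_n}) (m : 'X_{1..n}).

Lemma mcoeffXM (u m : 'X_{1..n}) (f : S) :
  ('X_[u] * f)@_m = if (u <= m)%MM then f@_(m - u) else 0.
Proof.
case: ifPn => [le_um|nle_um].
  by rewrite mulrC -{1}(submK le_um) addmC mcoeffMX.
apply/eqP; rewrite mcoeff_eq0; apply: contra nle_um => /msuppM_le.
rewrite msuppX => /allpairsP[[m1 m2] /= [m1u _ ->]].
by move: m1u; rewrite inE => /eqP->; rewrite lem_addr.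
Qed.

Definition below (j : 'I_n) G : nat := #|[set i in G | (i < j)%N]|.

Lemma belowU1 (i j : 'I_n) G :
  j \notin G -> below i (j |: G) = ((j < i) + below i G)%N.
Proof.
move=> jG; rewrite /below.
have -> : [set l in j |: G | (l < i)%N] =
    if (j < i)%N then j |: [set l in G | (l < i)%N] else [set l in G | (l < i)%N].
  apply/setP => l; case: ifPn => ji; rewrite !inE.
    by case: eqP => [->|_] //=; rewrite ji.
  by case: eqP => [->|_] //=; rewrite (negbTE ji) (negbTE jG).
by case: ifPn => ji //; rewrite cardsU1 !inE (negbTE jG).
Qed.

Lemma belowD1 (j : 'I_n) G : below j (G :\ j) = below j G.
Proof.
rewrite /below; congr #|pred_of_set _|; apply/setP => l; rewrite !inE.
by case: eqP => [->|_] //=; rewrite ltnn !andbF.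
Qed.

Definition expo_set G : 'X_{1..n} := [multinom if j \in G then k j else 0%N | j < n].

Definition expo (j : 'I_n) : 'X_{1..n} := (U_(j) *+ k j)%MM.

Lemma expoE (i j : 'I_n) : expo j i = if j == i then k j else 0%N.
Proof. by rewrite mulmnE mnm1E; case: eqP; rewrite ?mul1n ?mul0n. Qed.

Lemma expo_le (j : 'I_n) m : (expo j <= m)%MM = (k j <= m j)%N.
Proof.
apply/mnm_lepP/idP => [/(_ j)|le_km i]; first by rewrite expoE eqxx.
by rewrite expoE; case: eqP => [<-|].
Qed.

Lemma expo_setU1 (j : 'I_n) G :
  j \notin G -> expo_set (j |: G) = (expo j + expo_set G)%MM.
Proof.
move=> jG; apply/mnmP => i; rewrite mnmDE expoE !mnmE !inE.
by case: (eqVneq j i) => [<-|ji] //=; rewrite (negbTE jG) addn0.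
Qed.

Lemma mdeg_expo_set G : mdeg (expo_set G) = (\sum_(j in G) k j)%N.
Proof.
by rewrite mdegE [RHS]big_mkcond; apply: eq_bigr => j _; rewrite mnmE.
Qed.

(** The simplicial boundary of a chain, read coefficientwise: the value at G collects the values on
    sets with one more element. *)
Definition boundary (s : {set 'I_n} -> K) G : K :=
  \sum_(j | j \notin G) (-1) ^+ below j G * s (j |: G).

Section FixedRank.

Variable r : nat.
Implicit Type w : {ffun {set 'I_n} -> 'rV[S]_r}.

(** All exterior degrees live in one function on subsets, so the differential is an endomap;
    [homog_cochain] singles out a degree. *)
Definition koszul w : {ffun {set 'I_n} -> 'rV[S]_r} :=
  [ffun G : {set 'I_n} => \sum_(j | j \notin G)
     ((-1) ^+ below j G * 'X_[expo j]) *: w (j |: G)].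

Lemma mcoeff_sign c (f : S) m : ((-1) ^+ c * f)@_m = (-1) ^+ c * f@_m.
Proof.
by rewrite -signr_odd -[in RHS]signr_odd; case: odd; rewrite ?mulN1r ?mul1r ?mcoeffN.
Qed.

Lemma mcoeff_koszul w G a m : (koszul w G 0 a)@_m = \sum_(j | j \notin G)
  (-1) ^+ below j G *
    (if (k j <= m j)%N then (w (j |: G) 0 a)@_(m - expo j) else 0).
Proof.
rewrite ffunE summxE raddf_sum; apply: eq_bigr => j _ /=.
by rewrite mxE -mulrA mcoeff_sign mcoeffXM expo_le.
Qed.

Lemma koszulB : {morph koszul : v w / v - w}.
Proof.
move=> v w; apply/ffunP => G; rewrite !ffunE -sumrB.
by apply: eq_bigr => j _; rewrite !ffunE scalerBr.
Qed.

Lemma koszul0 : koszul 0 = 0.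
Proof. by rewrite -[in LHS](subrr 0) koszulB subrr. Qed.

(** The diagonal needs its own hypothesis, since antisymmetry only says that twice F i i is 0. *)
Lemma sum_antisym (V : zmodType) (F : 'I_n -> 'I_n -> V) :
  (forall i j, F i j = - F j i) -> (forall i, F i i = 0) ->
  \sum_i \sum_j F i j = 0.
Proof.
move=> FN F0.
have split_i i : \sum_j F i j =
    \sum_(j : 'I_n | (j < i)%N) F i j + \sum_(j : 'I_n | (i < j)%N) F i j.
  rewrite (bigID (fun j : 'I_n => (j < i)%N)) /=; congr (_ + _).
  rewrite (bigD1 i) ?ltnn //= F0 add0r; apply: eq_bigl => j.
  by rewrite -leqNgt [RHS]ltn_neqAle eq_sym andbC.
rewrite (eq_bigr _ (fun i _ => split_i i)) big_split /=.
rewrite [X in _ + X](exchange_big_dep predT) //= -big_split big1 // => i _.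
by rewrite -big_split big1 // => j _; rewrite /= FN addNr.
Qed.

Lemma koszul_koszul w : koszul (koszul w) = 0.
Proof.
apply/ffunP => G; rewrite !ffunE.
pose F (j i : 'I_n) : 'rV[S]_r := if [&& j \notin G, i \notin G & i != j] then
  ((-1) ^+ (below j G + below i (j |: G)) * ('X_[expo j] * 'X_[expo i]))
     *: w (i |: (j |: G)) else 0.
rewrite (_ : \sum_(_ | _) _ = \sum_j \sum_i F j i); last first.
  rewrite [LHS]big_mkcond; apply: eq_bigr => j _; rewrite /F.
  case: ifPn => jG; last by rewrite big1.
  rewrite ffunE scaler_sumr big_mkcond; apply: eq_bigr => i _.
  rewrite !inE negb_or /= andbC; case: ifP => // _.
  by rewrite scalerA exprD mulrACA.
apply: sum_antisym => [j i|i]; last by rewrite /F eqxx !andbF.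
rewrite /F andbCA [j == i]eq_sym; case: ifP => [/and3P[iG jG ij]|]; last by rewrite oppr0.
rewrite -scaleNr -mulNr (belowU1 _ iG) (belowU1 _ jG) setUCA ['X_[expo i] * _]mulrC.
congr ((_ * _) *: _); rewrite !exprD.
have /negbTE ij' : nat_of_ord i != j by [].
by case: (ltngtP i j) ij' => //= _ _; rewrite !expr1 !expr0; ring.
Qed.


(** The exterior basis element of G has degree the sum of the k_j with j in G, which makes [koszul]
    degree-preserving. *)
Definition homog_cochain (sh : 'I_r -> nat) q d w := forall G a m,
  (w G 0 a)@_m != 0 -> #|G| = q /\ (mdeg m + sh a + mdeg (expo_set G))%N = d.

Definition divX (j : 'I_n) (f : S) : S :=
  \sum_(m <- msupp f | (k j <= m j)%N) f@_m *: 'X_[m - expo j].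

Lemma mcoeff_divX j f m : (divX j f)@_m = f@_(m + expo j).
Proof.
rewrite /divX raddf_sum /= (eq_bigr (fun m' : 'X_{1..n} =>
  if m' == (m + expo j)%MM then f@_m' else 0)); last first.
  move=> m' le_km; rewrite mcoeffZ mcoeffX.
  rewrite (_ : (_ == m) = (m' == (m + expo j)%MM)).
    by case: eqP; rewrite ?mulr1 ?mulr0.
  apply/eqP/eqP => [<-|->]; last by rewrite addmK.
  by rewrite submK // expo_le.
rewrite -big_mkcondr /= -big_filter.
have [fm|fm] := boolP ((m + expo j)%MM \in msupp f); last first.
  rewrite big_filter big_seq_cond big1 => [|m' /and3P[fm' _ /eqP m'E]].
    by apply/esym/eqP; rewrite mcoeff_eq0.
  by rewrite -m'E fm' in fm.
rewrite (perm_big [:: (m + expo j)%MM]) ?big_seq1 //.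
apply: uniq_perm => // [|m']; first by rewrite filter_uniq ?msupp_uniq.
rewrite mem_filter !inE; case: eqP => [->|]; rewrite ?andbF //=.
by rewrite mnmDE expoE eqxx leq_addl fm.
Qed.

Definition homotopy (j : 'I_n) w : {ffun {set 'I_n} -> 'rV[S]_r} :=
  [ffun G : {set 'I_n} => if j \in G then
     (-1) ^+ below j G *: \row_a divX j (w (G :\ j) 0 a) else 0].

Lemma mcoeff_homotopy j w G a m : (homotopy j w G 0 a)@_m =
  if j \in G then (-1) ^+ below j G * (w (G :\ j) 0 a)@_(m + expo j) else 0.
Proof.
rewrite ffunE; case: ifP => _; last by rewrite mxE mcoeff0.
by rewrite !mxE mcoeff_sign mcoeff_divX.
Qed.

Lemma homog_homotopy sh q d j w :
  homog_cochain sh q d w -> homog_cochain sh q.+1 d (homotopy j w).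
Proof.
move=> hw G a m; rewrite mcoeff_homotopy; case: ifP => [jG|]; last by rewrite eqxx.
rewrite mulrI_eq0 => [/hw [cG dG]|]; last exact/lregX/lregN/lreg1.
have jG' : j \notin G :\ j by rewrite !inE eqxx.
split; first by rewrite (cardsD1 j) jG cG.
rewrite -dG -{1}(setD1K jG) expo_setU1 // !mdegD addnA.
by congr addn; rewrite addnAC.
Qed.

Lemma homog_koszul sh q d w :
  homog_cochain sh q.+1 d w -> homog_cochain sh q d (koszul w).
Proof.
move=> hw G a m; rewrite mcoeff_koszul.
case: (pickP [pred j | (j \notin G) && (k j <= m j)%N &&
    ((w (j |: G) 0 a)@_(m - expo j) != 0)]) => [j|no_j]; last first.
  rewrite big1 ?eqxx // => j jG; have := no_j j; rewrite /= jG /=.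
  by case: ifP => _ /=; [move/negbT/negPn/eqP=> -> | move=> _]; rewrite mulr0.
case/andP=> /andP[jG km] /hw [cG <-] _; split.
  by move: cG; rewrite cardsU1 jG => -[].
have -> : mdeg m = (mdeg (m - expo j) + mdeg (expo j))%N.
  by rewrite -mdegD submK ?expo_le.
by rewrite expo_setU1 // mdegD; lia.
Qed.

Lemma homog_cochain0 sh q d : homog_cochain sh q d 0.
Proof. by move=> G a m; rewrite ffunE mxE mcoeff0 eqxx. Qed.

Lemma homog_cochainB sh q d v w : homog_cochain sh q d v ->
  homog_cochain sh q d w -> homog_cochain sh q d (v - w).
Proof.
move=> hv hw G a m; rewrite !ffunE !mxE mcoeffB.
have [-> |/hv //] := eqVneq (v G 0 a)@_m 0.
by rewrite sub0r oppr_eq0 => /hw.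
Qed.

(* [homotopy j] contracts the j-th tensor factor S --x_j^(k_j)--> S of the Koszul
   complex onto its cokernel. *)
Lemma mcoeff_koszul_homotopy j w G a m : koszul w = 0 ->
  ((w - koszul (homotopy j w)) G 0 a)@_m =
  if (j \in G) || (k j <= m j)%N then 0 else (w G 0 a)@_m.
Proof.
move=> kw; rewrite ffunE [X in X + _]lock ffunE -lock !mxE mcoeffB mcoeff_koszul.
have [jG|jG] /= := boolP (j \in G); last first.
  rewrite (bigD1 j) //= big1 ?addr0 => [|i /andP[iG ij]]; last first.
    rewrite mcoeff_homotopy !inE eq_sym (negbTE ij) (negbTE jG) /=.
    by rewrite if_same mulr0.
  rewrite mcoeff_homotopy setU11 setU1K // belowU1 // ltnn.
  case: ifP => km; last by rewrite mulr0 subr0.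
  by rewrite submK ?expo_le // signrMK subrr.
have jG' : j \notin G :\ j by rewrite !inE eqxx.
have := mcoeff_koszul w (G :\ j) a (m + expo j).
rewrite kw ffunE mxE mcoeff0 (bigD1 j) //= setD1K // belowD1.
rewrite mnmDE expoE eqxx leq_addl addmK.
move/esym/eqP; rewrite addr_eq0 => /eqP wG.
apply/eqP; rewrite subr_eq0; apply/eqP/(can_inj (signrMK (below j G))).
rewrite wG mulr_sumr -sumrN; apply: eq_big => [i|i /andP[]].
  by rewrite !inE; case: eqP => [->|]; rewrite ?jG ?andbF ?andbT.
rewrite !inE => iG ij; rewrite ij /= in iG.
rewrite mcoeff_homotopy inE jG orbT mnmDE expoE eq_sym (negbTE ij) addn0.
case: ifP => km; last by rewrite !mulr0 oppr0.
have -> : (i |: G) :\ j = i |: G :\ j.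
  by apply/setP => l; rewrite !inE; case: eqP => [->|] //=; rewrite eq_sym (negbTE ij).
have -> : (m + expo j - expo i = m - expo i + expo j)%MM.
  have /mnm_lepP le_im : (expo i <= m)%MM by rewrite expo_le.
  by apply/mnmP => l; have := le_im l; rewrite !(mnmDE, mnmBE); lia.
have -> : below i G = ((j < i) + below i (G :\ j))%N.
  by rewrite -{1}(setD1K jG) belowU1.
rewrite belowU1 // !exprD; set x := (w _ _ _)@_ _.
rewrite -[x in LHS](signrMK (below j G)).
have ij' : (nat_of_ord i == j) = false by apply: negbTE.
by case: (ltngtP i j) ij' => //= _ _; rewrite !expr1 !expr0; ring.
Qed.

(** The variables are contracted one by one: subtracting [koszul (homotopy j w)] removes every term
    with j in G or x_j^(k_j) dividing it, and by assumption each term is removed by some j. For q =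
    0 this says that elements of the ideal (x_j^(k_j)) are boundaries. *)
Lemma koszul_exact sh q d w : homog_cochain sh q d w -> koszul w = 0 ->
  (forall G a m, (w G 0 a)@_m != 0 -> exists j, (j \in G) || (k j <= m j)%N) ->
  exists2 v, homog_cochain sh q.+1 d v & w = koszul v.
Proof.
move=> hw kw red_w.
have {red_w} : forall G a m, (w G 0 a)@_m != 0 ->
    exists2 j, j \in enum 'I_n & (j \in G) || (k j <= m j)%N.
  by move=> G a m /red_w[j]; exists j; rewrite ?mem_enum.
elim: (enum 'I_n) w hw kw => [|j s IHs] w hw kw red_w.
  exists 0 => [G a m|]; first by rewrite ffunE mxE mcoeff0 eqxx.
  have -> : w = 0.
    apply/ffunP => G; apply/rowP => a; apply/mpolyP => m.
    rewrite ffunE mxE mcoeff0; apply/eqP/negPn/negP => /red_w[j].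
    by rewrite in_nil.
  by rewrite koszul0.
have hh := homog_homotopy (j := j) hw.
have [||G a m|v hv wE] := IHs (w - koszul (homotopy j w)).
- by apply: homog_cochainB => //; apply: homog_koszul.
- by rewrite koszulB koszul_koszul kw subr0.
- rewrite mcoeff_koszul_homotopy //.
  case: ifPn => [|]; rewrite ?eqxx // negb_or => /andP[jG km] /red_w[j'].
  rewrite inE => /orP[/eqP->|]; last by exists j'.
  by rewrite (negbTE jG) (negbTE km).
(* This is [v + homotopy j w], phrased through closure under subtraction. *)
exists (v - (0 - homotopy j w)).
  by do 2!apply: homog_cochainB => //; apply: homog_cochain0.
by rewrite !koszulB -wE koszul0 sub0r opprK subrK.
Qed.

End FixedRank.
End Koszul.

(** * Multigraded slices and balancing *)

Section Slices.

Variables (K : fieldType) (n : nat) (k : 'I_n -> nat).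
Local Notation S := {mpoly K[n]}.
Local Notation cochain r := {ffun {set 'I_n} -> 'rV[S]_r}.
Implicit Types (G : {set 'I_n}) (m c : 'X_{1..n}).

Definition mulc r1 r2 (A : 'M[S]_(r1, r2)) (w : cochain r1) : cochain r2 :=
  [ffun G => w G *m A].

Lemma mulcB r1 r2 (A : 'M[S]_(r1, r2)) : {morph mulc A : v w / v - w}.
Proof. by move=> v w; apply/ffunP => G; rewrite !ffunE mulmxBl. Qed.

Lemma mulc_koszul r1 r2 (A : 'M[S]_(r1, r2)) w :
  mulc A (koszul k w) = koszul k (mulc A w).
Proof.
apply/ffunP => G; rewrite !ffunE mulmx_suml.
by apply: eq_bigr => j _; rewrite ffunE scalemxAl.
Qed.

Lemma mcoeff_mulmx_neq0 r1 r2 (A : 'M[S]_(r1, r2)) (v : 'rV_r1) a m :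
  ((v *m A) 0 a)@_m != 0 -> exists b m1 m2,
    [/\ m = (m1 + m2)%MM, (v 0 b)@_m1 != 0 & (A b a)@_m2 != 0].
Proof.
rewrite mxE raddf_sum /=.
case: (pickP [pred b | (v 0 b * A b a)@_m != 0]) => [b /= nz _|no_b]; last first.
  by rewrite big1 ?eqxx // => b _; apply/eqP; have /negbFE := no_b b.
have /msuppM_le/allpairsP[[m1 m2] /= [m1v m2A ->]] : m \in msupp (v 0 b * A b a).
  by rewrite mcoeff_msupp.
by exists b, m1, m2; rewrite -!mcoeff_msupp.
Qed.

Lemma mdeg_mulmx r1 r2 (A : 'M[S]_(r1, r2)) sh1 sh2 (v : 'rV_r1) a m :
  (forall b a, degree_preserving (sh1 b) (sh2 a) (A b a)) ->
  ((v *m A) 0 a)@_m != 0 ->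
  exists b m1, (v 0 b)@_m1 != 0 /\ (mdeg m + sh2 a = mdeg m1 + sh1 b)%N.
Proof.
move=> dA /mcoeff_mulmx_neq0[b [m1 [m2 [-> nz_v nz_A]]]].
exists b, m1; split=> //.
have [|le_sh /dhomogP hA] := dA b a.
  by apply: contraNneq nz_A => ->; rewrite mcoeff0.
have := hA m2; rewrite mcoeff_msupp => /(_ nz_A) m2E.
by rewrite mdegD m2E; lia.
Qed.

Lemma homog_mulc r1 r2 (A : 'M[S]_(r1, r2)) sh1 sh2 q d w :
  (forall b a, degree_preserving (sh1 b) (sh2 a) (A b a)) ->
  homog_cochain k sh1 q d w -> homog_cochain k sh2 q d (mulc A w).
Proof.
move=> dA hw G a m; rewrite ffunE => /(mdeg_mulmx dA)[b [m1 [/hw[cG <-] eq_d]]].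
by split=> //; rewrite eq_d.
Qed.

Definition mfilter (p : pred 'X_{1..n}) (f : S) : S :=
  \sum_(m <- msupp f | p m) f@_m *: 'X_[m].

Lemma mcoeff_mfilter p f m : (mfilter p f)@_m = if p m then f@_m else 0.
Proof.
rewrite raddf_sum /= -big_filter; case: ifPn => pm; last first.
  rewrite big_seq_cond big1 // => m'; rewrite mem_filter => /andP[/andP[pm' _] _].
  rewrite mcoeffZ mcoeffX; case: eqP => [m'E|]; rewrite ?mulr0 //.
  by rewrite -m'E pm' in pm.
have [fm|fm] := boolP (m \in msupp f).
  rewrite (bigD1_seq m) ?filter_uniq ?msupp_uniq ?mem_filter ?pm //=.
  rewrite mcoeffZ mcoeffX eqxx mulr1 big1 ?addr0 // => m' m'm.
  by rewrite mcoeffZ mcoeffX (negbTE m'm) mulr0.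
have -> : f@_m = 0 by apply/eqP; rewrite mcoeff_eq0.
rewrite big_seq_cond big1 // => m'; rewrite mem_filter => /andP[/andP[_ fm'] _].
rewrite mcoeffZ mcoeffX; case: eqP => [m'E|]; rewrite ?mulr0 //.
by rewrite -m'E fm' in fm.
Qed.

(** Any lift can be truncated to the required degree: the discarded part maps into other degrees
    only, while the difference of [w G] and the image of the truncation lives in degree d, so this
    difference vanishes. *)
Lemma homog_lift r1 r2 (A : 'M[S]_(r1, r2)) sh1 sh2 q d w :
  (forall b a, degree_preserving (sh1 b) (sh2 a) (A b a)) ->
  homog_cochain k sh2 q d w ->
  (forall G, exists v, w G = v *m A) ->
  exists2 v, homog_cochain k sh1 q d v & w = mulc A v.
Proof.
move=> dA hw liftw.
have {liftw} liftG G : exists v : 'rV_r1, (forall a m, (v 0 a)@_m != 0 ->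
    #|G| = q /\ (mdeg m + sh1 a + mdeg (expo_set k G))%N = d) /\ w G = v *m A.
  have [cG|cG] := eqVneq #|G| q; last first.
    exists 0; split=> [a m|]; first by rewrite mxE mcoeff0 eqxx.
    rewrite mul0mx; apply/rowP => a; apply/mpolyP => m; rewrite mxE mcoeff0.
    by apply/eqP/negPn/negP => /hw[cG']; rewrite cG' eqxx in cG.
  have [v wG] := liftw G.
  pose good (b : 'I_r1) m := ((mdeg m + sh1 b + mdeg (expo_set k G))%N == d).
  pose v' := \row_b mfilter (good b) (v 0 b).
  exists v'; split=> [a m|].
    by rewrite mxE mcoeff_mfilter; case: ifP => [/eqP dm|]; rewrite ?eqxx.
  apply/eqP; rewrite -subr_eq0; apply/eqP/rowP => a; apply/mpolyP => m.
  rewrite [in RHS]mxE mcoeff0; apply/eqP/negPn/negP => nz.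
  have [b [m1 [nz1 dm]]] : exists b m1,
      ((v - v') 0 b)@_m1 != 0 /\ (mdeg m + sh2 a = mdeg m1 + sh1 b)%N.
    by apply: (mdeg_mulmx dA); rewrite mulmxBl -wG.
  have gb : ~~ good b m1.
    by apply: contra nz1 => gb; rewrite !mxE mcoeffB mcoeff_mfilter gb subrr.
  have gm : (mdeg m + sh2 a + mdeg (expo_set k G))%N == d.
    have wvE : (w G - v' *m A) 0 a = w G 0 a - (v' *m A) 0 a by rewrite !mxE.
    move: nz; rewrite wvE mcoeffB.
    have [-> |/hw[_ ->]] := eqVneq (w G 0 a)@_m 0; last by rewrite eqxx.
    rewrite sub0r oppr_eq0 => /(mdeg_mulmx dA)[b' [m' [nz' ->]]].
    by move: nz'; rewrite mxE mcoeff_mfilter; case: ifP => //; rewrite eqxx.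
  by move: gb; rewrite /good -dm gm.
have [v hv] := fin_all_exists liftG.
exists [ffun G => v G] => [G a m|].
  by rewrite ffunE => /(proj1 (hv G)).
by apply/ffunP => G; rewrite !ffunE; case: (hv G).
Qed.

(** The component of multidegree c, where the basis element of G has multidegree [expo_set k G];
    [glue] is the inclusion of that component. *)
Definition slice c (w : cochain 1) G : K :=
  if (expo_set k G <= c)%MM then (w G 0 0)@_(c - expo_set k G) else 0.

Definition glue c (s : {set 'I_n} -> K) : cochain 1 :=
  [ffun G => const_mx
    (if (expo_set k G <= c)%MM then s G *: 'X_[c - expo_set k G] else 0)].

Lemma slice_glue c c' s G :
  slice c' (glue c s) G = if (c == c') && (expo_set k G <= c)%MM then s G else 0.
Proof.
rewrite /slice ffunE mxE; case: ifPn => [le_Gc'|nle_Gc'].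
  case: ifPn => le_Gc; rewrite ?andbF ?mcoeff0 // andbT mcoeffZ mcoeffX.
  rewrite (_ : (_ == _) = (c == c')); first by case: eqP; rewrite ?mulr1 ?mulr0.
  apply/eqP/eqP => [eq_c|->//].
  by rewrite -(submK le_Gc) eq_c submK.
by case: eqP => [->|] //=; rewrite (negbTE nle_Gc').
Qed.

Lemma slice_sum (J : finType) (p : pred J) (w : J -> cochain 1) c G :
  slice c (\sum_(i | p i) w i) G = \sum_(i | p i) slice c (w i) G.
Proof.
rewrite /slice; case: ifP => _; last by rewrite big1.
by rewrite sum_ffunE summxE raddf_sum.
Qed.

Lemma mcoeff_slice (w : cochain 1) G m : (w G 0 0)@_m = slice (m + expo_set k G) w G.
Proof. by rewrite /slice lem_addl addmK. Qed.

Lemma eq_slice (v w : cochain 1) : (forall c G, slice c v G = slice c w G) -> v = w.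
Proof.
move=> eq_vw; apply/ffunP => G; apply/rowP => a; apply/mpolyP => m.
by rewrite !ord1 !mcoeff_slice eq_vw.
Qed.

Lemma slice_koszul c (w : cochain 1) G : slice c (koszul k w) G = boundary (slice c w) G.
Proof.
rewrite {1}/slice; case: ifPn => [le_Gc|nle_Gc]; last first.
  rewrite /boundary big1 // => j jG; rewrite /slice expo_setU1 //.
  case: ifP => [/mnm_lepP le_jGc|]; last by rewrite mulr0.
  case/negP: nle_Gc; apply/mnm_lepP => i; apply: leq_trans (le_jGc i).
  by rewrite mnmDE leq_addl.
rewrite mcoeff_koszul; apply: eq_bigr => j jG; congr (_ * _).
rewrite /slice expo_setU1 //.
rewrite (_ : (k j <= _)%N = (expo k j + expo_set k G <= c)%MM).
  by congr (if _ then _ else _); congr (_@__); apply/mnmP => i;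
    rewrite !(mnmBE, mnmDE); lia.
rewrite -expo_le; apply/mnm_lepP/mnm_lepP => le_c i; have := le_c i;
  have /mnm_lepP/(_ i) := le_Gc; rewrite !(mnmBE, mnmDE); lia.
Qed.

Lemma homog_slice q d (w : cochain 1) :
  (forall c G, slice c w G != 0 -> #|G| = q /\ mdeg c = d) <->
  homog_cochain k (fun=> 0%N) q d w.
Proof.
split=> [hw G a m|hw c G].
  by rewrite ord1 mcoeff_slice => /hw[-> <-]; rewrite mdegD addn0.
rewrite /slice; case: ifP => le_Gc; last by rewrite eqxx.
by move=> /hw[-> <-]; rewrite addn0 -mdegD submK.
Qed.

End Slices.

Section Acyclic.

Variables (K : fieldType) (n : nat).
Implicit Types G : {set 'I_n}.

(** The index counts elements and the empty set is allowed as a face, so for a simplicial complex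
    this is vanishing of reduced homology in dimension i - 1. *)
Definition acyclic (Face : {set 'I_n} -> Prop) i :=
  forall s : {set 'I_n} -> K,
  (forall G, s G != 0 -> Face G /\ #|G| = i) ->
  (forall G, boundary s G = 0) ->
  exists2 t : {set 'I_n} -> K,
    (forall G, t G != 0 -> Face G /\ #|G| = i.+1) &
    forall G, s G = boundary t G.

Lemma eq_acyclic (Face Face' : {set 'I_n} -> Prop) i :
  (forall G, Face G <-> Face' G) -> acyclic Face i -> acyclic Face' i.
Proof.
move=> eqF acF s s_supp s_cycle.
have [|//|t t_supp sE] := acF s; first by move=> G /s_supp[/eqF].
by exists t => // G /t_supp[/eqF].
Qed.

End Acyclic.

Section Balance.

Variables (K : fieldType) (n : nat) (k : 'I_n -> nat).
Local Notation S := {mpoly K[n]}.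
Local Notation cochain r := {ffun {set 'I_n} -> 'rV[S]_r}.
Variables (I : S -> Prop) (F : free_complex K n).
Hypothesis graded_F : graded_complex F.
Hypothesis F_resolves : resolves F I.
Hypothesis monomial_I : forall f, I f <-> forall m, f@_m != 0 -> I 'X_[m].
Implicit Types (G : {set 'I_n}) (m c : 'X_{1..n}).

(* The part of multidegree c of the Koszul complex of (x_j ^ k_j) with
   coefficients in I is the chain complex of these faces. *)
Definition koszul_face c G :=
  (expo_set k G <= c)%MM /\ I 'X_[c - expo_set k G].

Variable d : nat.

(** The degree d part of the tensor product of F with the Koszul complex of the x_j^(k_j): the
    horizontal cokernel is the Koszul complex of I, the vertical one is F modulo the x_j^(k_j). *)
Let D (p q : nat) : zmodType := cochain (rk F p).
Let P p q (w : D p q) := homog_cochain k (@shift _ _ F p) q d w.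
Let dh p q (w : D p.+1 q) : D p q := mulc (diff F p) w.
Let dv p q (w : D p q.+1) : D p q := koszul k w.

Lemma bicomplex_antidiagonal i : zexact P dh dv 0 i <-> zexact P dh dv i 0.
Proof.
have [_ exF0 exF] := F_resolves; have [_ dF] := graded_F.
apply: zexact_antidiagonal =>
  [p q|p q|p q w|p q w|p q w|p q v w|p q w|p q w|p q w Pw w0|p q w Pw w0].
- exact: mulcB.
- exact: koszulB.
- by apply/ffunP => G; rewrite !ffunE; apply/(exF p); exists (w G).
- exact: koszul_koszul.
- by rewrite /dh /dv mulc_koszul.
- exact: homog_cochainB.
- exact: homog_mulc.
- exact: homog_koszul.
- apply: (homog_lift (dF p.+1)) => // G; apply/exF.
  by have /ffunP/(_ G) := w0; rewrite !ffunE.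
- apply: koszul_exact => // G a m /Pw[cG _].
  by have /card_gt0P[j jG] : (0 < #|G|)%N; [rewrite cG | exists j; rewrite jG].
Qed.

Let aug_degree b (a : 'I_1) : degree_preserving (shift b) 0 (aug F b a).
Proof. by rewrite ord1; apply: (proj1 graded_F). Qed.

Let koszul_size0 r sh (w : cochain r) : homog_cochain k sh 0 d w -> koszul k w = 0.
Proof.
move=> hw; apply/ffunP => G; apply/rowP => a; apply/mpolyP => m.
rewrite [in RHS]ffunE mxE mcoeff0 mcoeff_koszul big1 // => j jG.
case: ifP => _; last by rewrite mulr0.
have [->|/hw[]] := eqVneq (w (j |: G) 0 a)@_(m - expo k j) 0; first by rewrite mulr0.
by rewrite cardsU1 jG.
Qed.

Let mulc_aug (w : cochain (rk F 0)) G : I (mulc (aug F) w G 0 0).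
Proof. by have [exI _ _] := F_resolves; apply/exI; exists (w G); rewrite ffunE. Qed.

Let face_slice c (w : cochain (rk F 0)) q G :
  homog_cochain k (@shift _ _ F 0) q d w ->
  slice k c (mulc (aug F) w) G != 0 -> koszul_face c G /\ #|G| = q.
Proof.
move=> hw nz; have [cG _] := proj2 (homog_slice k q d _) (homog_mulc aug_degree hw) c G nz.
split=> //; move: nz; rewrite /slice; case: ifP => [le_Gc nz|]; last by rewrite eqxx.
by split=> //; move/monomial_I: (mulc_aug w G); apply.
Qed.

Let vcond_aug q (w : D 0 q) :
  P w -> koszul k (mulc (aug F) w) = 0 -> vcond P dh dv w.
Proof.
case: q w => [//|q] w Pw kz; have [_ exF0 _] := F_resolves.
apply: (homog_lift (proj2 graded_F 0)) => [|G]; first exact: homog_koszul.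
by apply/exF0; move: kz; rewrite -mulc_koszul => /ffunP/(_ G); rewrite !ffunE.
Qed.

Let lift_aug q (z : cochain 1) :
  (forall c G, slice k c z G != 0 -> [/\ koszul_face c G, #|G| = q & mdeg c = d]) ->
  exists2 w, homog_cochain k (@shift _ _ F 0) q d w & z = mulc (aug F) w.
Proof.
have [exI _ _] := F_resolves => hz.
apply: (homog_lift aug_degree) => [|G].
  by apply/homog_slice => c G /hz[].
have /exI[v vE] : I (z G 0 0).
  apply/monomial_I => m; rewrite (mcoeff_slice k) => /hz[[_]].
  by rewrite addmK.
by exists v; apply/matrixP => i j; rewrite !ord1 vE.
Qed.

(** The image of w in the Koszul complex of I is a cycle; its multigraded slices bound separately,
    the bounding chains are glued and lifted to F_0, and the remaining error lies in the kernel of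
    [aug F], so it comes from F_1. *)
Lemma zexact_of_acyclic i :
  (forall c, mdeg c = d -> acyclic K (koszul_face c) i) -> zexact P dh dv 0 i.
Proof.
move=> acI w Pw _ vw; pose z := mulc (aug F) w.
have [_ exF0 _] := F_resolves.
have hz : homog_cochain k (fun=> 0%N) i d z := homog_mulc aug_degree Pw.
have kz : koszul k z = 0.
  case: i {acI} w Pw vw @z hz => [|i] w Pw vw z hz; first exact: koszul_size0 hz.
  have [v _ kw] := vw; rewrite -mulc_koszul -[koszul k w]/(dv w) kw.
  by apply/ffunP => G; rewrite !ffunE; apply/exF0; exists (v G).
(* Exponents of degree at most d form a finite type, which allows a simultaneous choice of the
   bounding chains. *)
have [t ht] : exists t : 'X_{1..n < d.+1} -> {set 'I_n} -> K,
    forall c : 'X_{1..n < d.+1},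
    mdeg c = d -> (forall G, t c G != 0 -> koszul_face c G /\ #|G| = i.+1) /\
    forall G, slice k c z G = boundary (t c) G.
  apply: (@fin_all_exists _ (fun=> {set 'I_n} -> K) (fun (c : 'X_{1..n < d.+1}) t =>
    mdeg c = d -> (forall G, t G != 0 -> koszul_face c G /\ #|G| = i.+1) /\
    forall G, slice k c z G = boundary t G)) => c.
  have [dc|/eqP dc] := eqVneq (mdeg c) d; last by exists (fun=> 0).
  have [|G|t t_face tE] := acI c dc (slice k c z); last by exists t.
    by move=> G; apply: face_slice.
  by rewrite -slice_koszul kz /slice ffunE mxE mcoeff0 if_same.
pose T := \sum_(c : 'X_{1..n < d.+1} | mdeg c == d) glue k c (t c).
have sliceT c G : slice k c T G != 0 -> mdeg c = d.
  rewrite slice_sum; case: (eqVneq (mdeg c) d) => // dc.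
  rewrite big1 ?eqxx // => c' /eqP dc'; rewrite slice_glue.
  by case: (bmnm c' =P c) => // cc'; rewrite -cc' dc' eqxx in dc.
have sliceTE (c : 'X_{1..n < d.+1}) G : mdeg c = d -> slice k c T G = t c G.
  move=> dc; rewrite slice_sum (bigD1 c) ?dc //= big1 ?addr0 => [|c' /andP[_ c'c]].
    rewrite slice_glue eqxx /=; case: ifPn => // nle_Gc.
    have [//|/(proj1 (ht c dc))[[]]] := eqVneq (t c G) 0.
    by rewrite (negbTE nle_Gc).
  by rewrite slice_glue (inj_eq val_inj) (negbTE c'c).
have bounded c : mdeg c = d -> exists c' : 'X_{1..n < d.+1}, c = c'.
  by move=> dc; have lt_cd : (mdeg c < d.+1)%N; [rewrite dc | exists (BMultinom lt_cd)].
have [|tau Ptau TE] := @lift_aug i.+1 T.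
  move=> c G nz; have dc := sliceT c G nz.
  have [c' cE] := bounded c dc; move: dc nz; rewrite cE => dc.
  by rewrite sliceTE // => /(proj1 (ht c' dc) G)[fG cG].
have kT : koszul k T = z.
  apply: (eq_slice (k := k)) => c G; rewrite slice_koszul.
  have [dc|dc] := eqVneq (mdeg c) d.
    have [c' cE] := bounded c dc; rewrite {}cE in dc *.
    rewrite (proj2 (ht c' dc)).
    by apply: eq_bigr => j _; rewrite sliceTE.
  rewrite (_ : slice k c z G = 0); last first.
    apply/eqP; apply: contraNT dc => nz.
    by have [_ ->] := proj2 (homog_slice k i d z) hz c G nz.
  rewrite /boundary big1 // => j _.
  by rewrite (_ : slice k c T _ = 0) ?mulr0 //; apply/eqP; apply: contraNT dc => /sliceT/eqP.
have [|G|s Ps sE] := homog_lift (k := k) (q := i) (d := d) (proj2 graded_F 0)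
    (w := w - koszul k tau).
- by apply: homog_cochainB => //; apply: homog_koszul.
- apply/exF0; have := mulcB (aug F) w (koszul k tau).
  rewrite mulc_koszul -TE kT subrr => /ffunP/(_ G).
  by rewrite !ffunE.
by exists s, tau; split; rewrite // -[X in _ = X + _]sE subrK.
Qed.

(** A simplicial cycle is glued into multidegree c and lifted to F_0; the slice at c of the
    resulting Koszul primitive bounds it. *)
Lemma acyclic_of_zexact i : zexact P dh dv 0 i ->
  forall c, mdeg c = d -> acyclic K (koszul_face c) i.
Proof.
move=> zx c dc s s_face s_cycle; pose z := glue k c s.
have [_ exF0 _] := F_resolves.
have zE c' G : slice k c' z G = if c == c' then s G else 0.
  rewrite slice_glue; case: eqP => //= _; case: ifPn => // nle_Gc.
  have [//|/s_face[[]]] := eqVneq (s G) 0.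
  by rewrite (negbTE nle_Gc).
have kz : koszul k z = 0.
  apply: (eq_slice (k := k)) => c' G; rewrite slice_koszul.
  rewrite [RHS]/slice ffunE mxE mcoeff0 if_same.
  have [<-|cc'] := eqVneq c c'.
    by apply: etrans (s_cycle G); apply: eq_bigr => j _; rewrite zE eqxx.
  by rewrite /boundary big1 // => j _; rewrite zE (negbTE cc') mulr0.
have [|w Pw wE] := @lift_aug i z.
  by move=> c' G; rewrite zE; case: (c =P c') => [<- /s_face[]|]; rewrite ?eqxx.
have vw : vcond P dh dv (w : D 0 i) by apply: vcond_aug; rewrite // -wE.
have [s' [t [Ps' Pt wE']]] := zx w Pw Logic.I vw.
have zT : z = mulc (aug F) (koszul k t).
  have -> : koszul k t = w - mulc (diff F 0) s'.
    by rewrite wE' addrAC subrr add0r.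
  rewrite mulcB -wE (_ : mulc (aug F) _ = 0) ?subr0 //.
  apply/ffunP => G; rewrite [LHS]ffunE [RHS]ffunE.
  by apply/exF0; exists (s' G); rewrite ffunE.
exists (slice k c (mulc (aug F) t)) => [G|G]; first exact: face_slice.
by rewrite -slice_koszul -mulc_koszul -zT zE eqxx.
Qed.

(** Vanishing modulo the ideal (x_1^(k_1), ..., x_n^(k_n)), tested on monomials. *)
Definition in_powers r (v : 'rV[S]_r) :=
  forall a m, (v 0 a)@_m != 0 -> exists j, (k j <= m j)%N.

Definition tor_cycle i : 'rV[S]_(rk F i) -> Prop :=
  match i with
  | 0 => fun=> True
  | i'.+1 => fun w => in_powers (w *m diff F i')
  end.

Let in_powers_koszul r (w : cochain r) G : in_powers (koszul k w G).
Proof.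
move=> a m; rewrite mcoeff_koszul.
case: (pickP [pred j | (k j <= m j)%N]) => [j|no_j]; first by exists j.
by rewrite big1 ?eqxx // => j _; have := no_j j => /= ->; rewrite mulr0.
Qed.

(** The vector w is placed at the empty set; [koszul_exact] turns being a cycle modulo the powers
    into [hcond]. *)
Lemma tor_vanishing i (w : 'rV[S]_(rk F i)) :
  (forall c, mdeg c = d -> acyclic K (koszul_face c) i) ->
  (forall a m, (w 0 a)@_m != 0 -> (mdeg m + shift a)%N = d) ->
  tor_cycle w -> exists s, in_powers (w - s *m diff F i).
Proof.
move=> /zexact_of_acyclic/bicomplex_antidiagonal zx hw cw.
pose om : D i 0 := [ffun G => if G == set0 then w else 0].
have Pom : P om.
  move=> G a m; rewrite ffunE; case: (G =P set0) => [->|_]; last by rewrite mxE mcoeff0 eqxx.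
  by rewrite cards0 mdeg_expo_set big_set0 addn0 => /hw.
have hom : hcond P dh dv om.
  case: i {zx} w hw cw @om Pom => [//|i] w hw cw om Pom.
  have Pd : homog_cochain k (@shift _ _ F i) 0 d (mulc (diff F i) om).
    exact: homog_mulc (proj2 graded_F i) Pom.
  apply: (koszul_exact Pd); first exact: koszul_size0 Pd.
  move=> G a m; rewrite !ffunE; case: (G =P set0) => [->|_]; last first.
    by rewrite mul0mx mxE mcoeff0 eqxx.
  by move=> /cw[j]; exists j; apply/orP; right.
have [s [t [_ _ omE]]] := zx om Pom hom Logic.I.
exists (s set0); have -> : w - s set0 *m diff F i = koszul k t set0.
  have /ffunP/(_ set0) := omE; rewrite [in LHS]ffunE eqxx => ->.
  by rewrite ffunE [dh _ _]ffunE addrAC subrr add0r.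
exact: in_powers_koszul.
Qed.

(** If F_i modulo the powers is zero in degree d, every element at (i, 0) is already a Koszul
    boundary. *)
Lemma acyclic_of_in_powers i :
  (forall w : 'rV[S]_(rk F i),
    (forall a m, (w 0 a)@_m != 0 -> (mdeg m + shift a)%N = d) -> in_powers w) ->
  forall c, mdeg c = d -> acyclic K (koszul_face c) i.
Proof.
move=> powF; apply/acyclic_of_zexact/bicomplex_antidiagonal => w Pw _ _.
have [G a m nz|t Pt wE] := koszul_exact Pw (koszul_size0 Pw).
  have [cG _] := Pw G a m nz; have {}cG : G = set0 by apply/cards0_eq.
  have w0 b m' : (w set0 0 b)@_m' != 0 -> (mdeg m' + shift b)%N = d.
    by move=> /Pw[_]; rewrite mdeg_expo_set big_set0 addn0.
  rewrite cG in nz; have [j km] := powF _ w0 a m nz.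
  by exists j; rewrite km orbT.
exists 0, t; split=> //; first exact: homog_cochain0.
rewrite (_ : dh _ = 0) ?add0r //.
by apply/ffunP => G; rewrite !ffunE mul0mx.
Qed.

End Balance.

(** * Monomial ideals *)

Section MonomialIdeals.

Variables (K : fieldType) (n : nat).
Local Notation S := {mpoly K[n]}.
Implicit Types (A : 'X_{1..n} -> Prop) (I J : S -> Prop) (m u v : 'X_{1..n}).

Lemma ideal_span_mcoeff (B : S -> Prop) f m : ideal_span B f -> f@_m != 0 ->
  exists h m1 m2, [/\ B h, h@_m2 != 0 & m = (m1 + m2)%MM].
Proof.
move=> [s [sB ->]]; rewrite raddf_sum /= => nz.
case: (boolP (has (fun c : S * S => (c.1 * c.2)@_m != 0) s)) => [/hasP|/hasPn no_c].
  move=> [c cs]; rewrite -mcoeff_msupp => /msuppM_le/allpairsP[[m1 m2] /= [_ mc2 ->]].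
  by exists c.2, m1, m2; rewrite -mcoeff_msupp; split=> //; apply: sB.
by move: nz; rewrite big_seq big1 ?eqxx // => c /no_c/negPn/eqP.
Qed.

Lemma ideal_span_of_monomials (B : S -> Prop) f :
  (forall m, f@_m != 0 -> exists m1 h, B h /\ 'X_[m] = 'X_[m1] * h) ->
  ideal_span B f.
Proof.
move=> fB; rewrite [f]mpolyE; have: {subset msupp f <= msupp f} by [].
elim: {1 3}(msupp f) => [|m s IHs] sub.
  by exists [::]; split; rewrite ?big_nil.
have [l sl|l [lB lE]] := IHs; first by apply: sub; rewrite inE sl orbT.
have nz : f@_m != 0 by rewrite -mcoeff_msupp sub ?mem_head.
have [m1 [h [Bh hE]]] := fB m nz.
exists ((f@_m *: 'X_[m1], h) :: l); split=> [c|].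
  by rewrite inE => /orP[/eqP->|/lB].
by rewrite !big_cons lE hE scalerAl.
Qed.

Lemma monomial_spanP A (f : S) : monomial_span A f <->
  forall m, f@_m != 0 -> exists2 u, A u & (u <= m)%MM.
Proof.
split=> [spf m /(ideal_span_mcoeff spf)[_ [m1 [m2 [[u Au ->]]]]]|fA].
  rewrite mcoeffX; case: (u =P m2) => [<- _ ->|]; last by rewrite eqxx.
  by exists u; rewrite // lem_addl.
apply: ideal_span_of_monomials => m /fA[u Au le_um].
by exists (m - u)%MM, 'X_[u]; split; [exists u | rewrite -mpolyXD submK].
Qed.

Lemma mcoeffXE_neq0 m m' : (('X_[m] : S)@_m' != 0) = (m == m').
Proof. by rewrite mcoeffX; case: (m =P m') => _; rewrite ?oner_eq0 ?eqxx. Qed.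

Lemma monomial_spanX A m : monomial_span A ('X_[m] : S) <-> exists2 u, A u & (u <= m)%MM.
Proof.
split=> [/monomial_spanP/(_ m)|Am]; first by rewrite mcoeffXE_neq0 eqxx => /(_ isT).
by apply/monomial_spanP => m'; rewrite mcoeffXE_neq0 => /eqP <-.
Qed.

Definition monomials_of I m := I 'X_[m].

Lemma monomial_idealP I f : monomial_ideal I ->
  I f <-> forall m, f@_m != 0 -> monomials_of I m.
Proof.
move=> [A IA]; rewrite IA monomial_spanP.
by split=> fA m /fA; rewrite /monomials_of IA monomial_spanX.
Qed.

Lemma monomials_ofS I u m : monomial_ideal I ->
  monomials_of I u -> (u <= m)%MM -> monomials_of I m.
Proof.
move=> [A IA]; rewrite /monomials_of !IA !monomial_spanX => -[u' Au' le_u'u le_um].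
by exists u' => //; apply: lepm_trans le_um.
Qed.

Fixpoint mon_pow A e v : Prop :=
  if e is e'.+1 then
    exists u1 u2, [/\ A u1, mon_pow A e' u2 & (u1 + u2 <= v)%MM]
  else True.

Lemma mon_powMn A e u v : A u -> (u *+ e <= v)%MM -> mon_pow A e v.
Proof.
elim: e v => [//|e IHe] v Au le_uv; exists u, (u *+ e)%MM; split=> //.
  by apply: IHe => //; apply/mnm_lepP.
by rewrite -mulmS.
Qed.

Lemma ideal_powP I e f : monomial_ideal I ->
  ideal_pow I e f <-> forall v, f@_v != 0 -> mon_pow (monomials_of I) e v.
Proof.
move=> monI; elim: e f => [//|e IHe] f /=; split=> [spf v|fI].
  move/(ideal_span_mcoeff spf) => [_ [m1 [m2 [[f1 [f2 [If1 If2 ->]]]]]]].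
  rewrite -mcoeff_msupp => /msuppM_le/allpairsP[[u1 u2] /= [uf1 uf2 ->]] ->.
  exists u1, u2; split; last exact: lem_addl.
    by have /(monomial_idealP _ monI) := If1; apply; rewrite -mcoeff_msupp.
  by have /IHe := If2; apply; rewrite -mcoeff_msupp.
apply: ideal_span_of_monomials => v /fI[u1 [u2 [Iu1 pu2 le_uv]]].
exists (v - (u1 + u2))%MM, ('X_[u1] * 'X_[u2]); split.
  exists 'X_[u1], 'X_[u2]; split=> //; apply/IHe => u'.
  by rewrite mcoeffXE_neq0 => /eqP <-.
by rewrite -!mpolyXD submK.
Qed.

Lemma ideal_powXP I e v : monomial_ideal I ->
  monomials_of (ideal_pow I e) v <-> mon_pow (monomials_of I) e v.
Proof.
move=> monI; rewrite /monomials_of ideal_powP //.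
split=> [/(_ v)|pv m]; rewrite mcoeffXE_neq0; first by rewrite eqxx => /(_ isT).
by move/eqP <-.
Qed.

(** The monomial x^v is a root of T^e - x^(ev), an integral equation whose only nonzero coefficient
    is the last one. *)
Lemma integrally_closed_mon_pow I e v : monomial_ideal I -> integrally_closed I ->
  (0 < e)%N -> mon_pow (monomials_of I) e (v *+ e) -> monomials_of I v.
Proof.
move=> monI clI e_gt0 pv; apply/clI.
exists e, (fun i => if i == e then - 'X_[v *+ e] else 0); split=> // [i _|].
  apply/ideal_powP => // u; case: (i =P e) => [->|_]; last by rewrite mcoeff0 eqxx.
  by rewrite mcoeffN oppr_eq0 mcoeffXE_neq0 => /eqP <-.
rewrite big_nat_recr //= eqxx subnn expr0 mulr1 big_nat big1 => [|i /andP[_ lt_ie]].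
  by rewrite add0r -mpolyXn subrr.
by rewrite (ltn_eqF lt_ie) mul0r.
Qed.

Lemma gap_generator I g v : is_gamma I g -> monomials_of I v ->
  exists u, [/\ monomials_of I u, (u <= v)%MM & forall j, (0 < u j)%N -> (g <= u j)%N].
Proof.
rewrite /monomials_of => -[A [[IA _] _ gA]] /IA/monomial_spanX[u Au le_uv].
exists u; split=> // [|j]; last exact: gA.
by apply/IA/monomial_spanX; exists u => //; apply/mnm_lepP.
Qed.

End MonomialIdeals.

(** * Regularity *)

Section Regularity.

Variables (K : fieldType) (n : nat).
Local Notation S := {mpoly K[n]}.
Variables (I : S -> Prop) (F : free_complex K n).
Hypothesis monomial_I : monomial_ideal I.
Hypothesis graded_F : graded_complex F.
Hypothesis F_resolves : resolves F I.

Let monP f : I f <-> forall m, f@_m != 0 -> I 'X_[m].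
Proof. exact: monomial_idealP. Qed.

(** Some monomial of a homogeneous entry of [aug F] divides x^v; it lies in I because I is
    monomial. *)
Lemma generator_degree v : monomials_of I v ->
  exists u a, [/\ monomials_of I u, (u <= v)%MM & mdeg u = @shift _ _ F 0 a].
Proof.
have [exI _ _] := F_resolves.
move=> /exI[w vE].
have : ((w *m aug F) 0 0)@_v != 0 by rewrite -vE mcoeffXE_neq0.
move=> /mcoeff_mulmx_neq0[a [m1 [m2 [-> _ nz]]]].
exists m2, a; split; last 1 first.
- have [|_ /dhomogP hom_a] := proj1 graded_F a.
    by apply: contraNneq nz => ->; rewrite mcoeff0.
  by rewrite subn0 in hom_a; apply: hom_a; rewrite mcoeff_msupp.
- suff /monP : I (aug F a 0) by apply.
  apply/exI; by exists (delta_mx 0 a); rewrite -rowE mxE.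
- exact: lem_addl.
Qed.

Section TopBetti.

Hypothesis minimal_F : minimal_complex F.
Variables (i : nat) (a : 'I_(rk F i)) (N : nat).
Hypothesis N_gt0 : (0 < N)%N.
Let k := fun _ : 'I_n => N.
Let top : 'X_{1..n} := [multinom N.-1 | j < n].

(* The socle element x^(N-1) e_a of F_i / (x_1^N, ..., x_n^N) F_i is a cycle
   by minimality. *)
Lemma top_not_acyclic :
  (forall s : 'rV_(rk F i.+1), ((s *m diff F i) 0 a)@_top = 0) ->
  ~ (forall c : 'X_{1..n}, mdeg c = (shift a + n * N.-1)%N -> acyclic K (koszul_face k I c) i).
Proof.
move=> no_top acI; pose w : 'rV[S]_(rk F i) := 'X_[top] *: delta_mx 0 a.
have wE b m : (w 0 b)@_m = ((b == a) && (m == top))%:R.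
  rewrite !mxE eqxx /= mulr_natr mcoeffMn mcoeffX [top == m]eq_sym.
  by case: (b == a); case: (m == top).
have mdeg_top : mdeg top = (n * N.-1)%N.
  rewrite mdegE (eq_bigr (fun=> N.-1)) => [|j _]; last by rewrite mnmE.
  by rewrite sum_nat_const card_ord.
have [b m||s] := tor_vanishing (w := w) graded_F F_resolves monP acI.
- rewrite wE; case: (b =P a) => [->|_]; last by rewrite eqxx.
  case: (m =P top) => [->|_]; last by rewrite eqxx.
  by rewrite mdeg_top addnC.
- rewrite /w; move: minimal_F a; case: (i) => [//|i'] minF a' b m /=.
  rewrite -scalemxAl mxE mcoeffXM; case: ifP => [le_top|]; last by rewrite eqxx.
  rewrite -rowE mxE => nz; have : (m - top)%MM != 0%MM.
    by apply: contraNneq nz => ->; rewrite minF.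
  move=> /eqP/mnmP nz_m.
  have [j nz_j] : exists j, (m - top)%MM j != 0%N.
    apply/existsP; apply: contraT; rewrite negb_exists => /forallP z.
    by case: nz_m => j; rewrite mnm0E; apply/eqP; have := z j; rewrite negbK.
  by exists j; move: nz_j; rewrite mnmBE mnmE /k; lia.
have -> : w - s *m diff F i = \row_b (w 0 b - (s *m diff F i) 0 b).
  by apply/rowP => b; rewrite !mxE.
(* The coefficient of x^(N-1) e_a in the difference is still 1, although no exponent there reaches
   N. *)
move=> /(_ a top); rewrite mxE mcoeffB no_top subr0 wE !eqxx oner_eq0 => /(_ isT)[j].
by rewrite mnmE /k; lia.
Qed.

End TopBetti.

(** By pigeonhole, a monomial of degree above the sum of the k_j - 1 is divisible by some x_j^(k_j).
    Contrapositively, a non-acyclic complex forces a generator of F_i of large degree. *)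
Lemma high_degree_acyclic (k : 'I_n -> nat) c i :
  (forall a : 'I_(rk F i), (shift a + \sum_j k j < mdeg c + n)%N) ->
  acyclic K (koszul_face k I c) i.
Proof.
move=> high.
apply: (acyclic_of_in_powers graded_F F_resolves monP (d := mdeg c)) => // w hw a m /hw dm.
have := high a; rewrite -dm => lt_m; apply/existsP; apply: contraT.
rewrite negb_exists => /forallP lt_k.
have : (mdeg m + n <= \sum_j k j)%N; last by lia.
rewrite mdegE -[n in (_ + n)%N]card_ord -sum1_card -big_split /=.
by apply: leq_sum => j _; rewrite addn1 ltnNge.
Qed.

End Regularity.

(** * Transfer of Koszul faces from an ideal to its powers *)

Section Transfer.

Variables (n : nat) (A : 'X_{1..n} -> Prop) (g e R : nat).
Implicit Types (u v c : 'X_{1..n}) (G : {set 'I_n}).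
Hypothesis e_gt0 : (0 < e)%N.
Hypothesis A_up : forall u v, A u -> (u <= v)%MM -> A v.
Hypothesis A_gap : forall v, A v ->
  exists u, [/\ A u, (u <= v)%MM & forall j, (0 < u j)%N -> (g <= u j)%N].
Hypothesis A_generated : forall v, A v ->
  exists u, [/\ A u, (u <= v)%MM & (mdeg u <= R)%N].
Hypothesis A_root : forall v, mon_pow A e (v *+ e) -> A v.

(** Pigeonhole: either the first factor has exponent below g at j, or the remaining factors have
    total exponent below g (e - 1). *)
Lemma mon_pow_small j v : mon_pow A e v -> (v j < g * e)%N ->
  exists u, [/\ A u, (u <= v)%MM & (u j < g)%N].
Proof.
elim: (e) v => [|e' IHe] v; first by rewrite muln0.
move=> [u1 [u2 [Au1 pu2 /mnm_lepP le_uv]]] lt_v.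
have [lt_u1|le_u1] := ltnP (u1 j) g.
  by exists u1; split=> //; apply/mnm_lepP => l; have := le_uv l; rewrite mnmDE; lia.
have [|u [Au /mnm_lepP le_uu2 lt_u]] := IHe u2 pu2.
  by have := le_uv j; rewrite mnmDE; rewrite mulnS in lt_v; lia.
exists u; split=> //; apply/mnm_lepP => l.
by have := le_uv l; have := le_uu2 l; rewrite mnmDE; lia.
Qed.

Let face k c G := (expo_set k G <= c)%MM /\ A (c - expo_set k G)%MM.
Let pow_face k c G := (expo_set k G <= c)%MM /\ mon_pow A e (c - expo_set k G)%MM.

Lemma expo_set_le k c G :
  (expo_set k G <= c)%MM <-> forall j, j \in G -> (k j <= c j)%N.
Proof.
split=> [/mnm_lepP le_c j jG|le_c]; first by have := le_c j; rewrite mnmE jG.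
by apply/mnm_lepP => j; rewrite mnmE; case: ifP => // /le_c.
Qed.

Lemma sum_const_ord N : (\sum_(j < n) N = n * N)%N.
Proof. by rewrite sum_nat_const card_ord. Qed.

Variable N : nat.
Let kN := fun _ : 'I_n => N.

(* Faces of both complexes avoid the j with c_j < N; the values of k' there keep
   c'_j - k'_j equal to c_j - N, while c'_j - k'_j = e (c_j - N) elsewhere. *)
Lemma transfer_large c : (g <= \sum_j (c j - N))%N ->
  exists k' c', (forall G, pow_face k' c' G <-> face kN c G) /\
    (mdeg c + \sum_j k' j + g * (e - 1) <= mdeg c' + n * N)%N.
Proof.
move=> gP; pose k' j := (if N <= c j then e * N else (e - 1) * c j + N)%N.
have mulc j : (e * c j = (e - 1) * c j + c j)%N by rewrite mulnBl mul1n subnK ?leq_pmull.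
have mulN : (e * N = (e - 1) * N + N)%N by rewrite mulnBl mul1n subnK ?leq_pmull.
have k'_le j : (k' j <= e * c j)%N = (N <= c j)%N.
  rewrite /k'; case: (leqP N (c j)) => [le_N|lt_N]; first by rewrite leq_mul.
  by rewrite mulc leq_add2l leqNgt lt_N.
exists k', (c *+ e)%MM; split=> [G|].
  have le_iff : (expo_set k' G <= c *+ e)%MM <-> (expo_set kN G <= c)%MM.
    by split=> /expo_set_le le_c; apply/expo_set_le => j /le_c;
      rewrite mulmnE mulnC k'_le.
  have diffE : (expo_set kN G <= c)%MM ->
      (c *+ e - expo_set k' G = (c - expo_set kN G) *+ e)%MM.
    move=> /expo_set_le le_c; apply/mnmP => j; rewrite !(mnmBE, mulmnE, mnmE).
    case: ifP => [/le_c le_Nc|_]; last by rewrite !subn0.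
    by rewrite /k' le_Nc mulnBl (mulnC N).
  split=> [[/le_iff le_c]|[le_c Ac]].
    by rewrite diffE // => /A_root.
  by split; [apply/le_iff | rewrite diffE //; apply: mon_powMn Ac _; apply/mnm_lepP].
have -> : mdeg (c *+ e) = (e * mdeg c)%N by rewrite mdegMn mulnC.
(* Summing this termwise identity, the excesses c_j - N contribute at least g (e - 1), as
   required. *)
have sumE : (\sum_j (e * c j + N) = \sum_j (c j + k' j + (e - 1) * (c j - N)))%N.
  apply: eq_bigr => j _; rewrite /k'; case: (leqP N (c j)) => le_cN.
    by rewrite mulnBr mulc mulN; have := leq_mul (leqnn (e - 1)) le_cN; lia.
  have -> : (c j - N = 0)%N by lia.
  by rewrite muln0 mulc; lia.
move: sumE; rewrite !big_split /= -!big_distrr /= -mdegE sum_const_ord.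
by move=> ->; rewrite leq_add2l [X in (_ <= X)%N]mulnC leq_mul.
Qed.

(* Here c'_j - k'_j = c_j - N when c_j < N, and otherwise c'_j - k'_j is 0, or
   g e - 1 for one index j0. As generators have no exponents in (0, g), the
   exponents c_j - N < g do not affect membership in I, and among e factors with
   total exponent of x_(j0) at most g e - 1 some factor does not involve x_(j0). *)
Lemma transfer_small c : (0 < g)%N -> (R + g + n < N)%N ->
  (n * N < mdeg c + n)%N -> (\sum_j (c j - N) < g)%N ->
  exists k' c', (forall G, pow_face k' c' G <-> face kN c G) /\
    (mdeg c + \sum_j k' j + g * (e - 1) <= mdeg c' + n * N)%N.
Proof.
move=> g_gt0 N_big c_big small.
have [j0 le_Nj0] : exists j, (N <= c j)%N.
  apply/existsP; apply: contraTT c_big; rewrite negb_exists -leqNgt => /forallP lt_c.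
  rewrite mdegE -[n in (_ + n)%N]muln1 -!sum_const_ord -big_split /=.
  by apply: leq_sum => j _; have := lt_c j; lia.
have sumE : (mdeg c + \sum_j (N - c j) = n * N + \sum_j (c j - N))%N.
  by rewrite mdegE -sum_const_ord -!big_split; apply: eq_bigr => j _ /=; lia.
(* By [sumE] the total deficit of the c_j below N is less than n + g, whereas N > R + g + n. *)
have le_R j : (R <= c j)%N.
  have : (N - c j <= \sum_j (N - c j))%N by rewrite (bigD1 j) //= leq_addr.
  by lia.
have le_cP j : (c j < N + g)%N.
  have : (c j - N <= \sum_j (c j - N))%N by rewrite (bigD1 j) //= leq_addr.
  by lia.
have mulc j : (e * c j = (e - 1) * c j + c j)%N by rewrite mulnBl mul1n subnK ?leq_pmull.
(* M cancels in c' - k' on G; off G it leaves room for e times any exponent vector below c. *)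
pose M := (e * mdeg c)%N.
(* The value g e - 1 is the largest total exponent to which [mon_pow_small] applies. *)
pose b j := (if j == j0 then g * e - 1 else 0)%N.
pose k' j := (if N <= c j then M else (e - 1) * c j + N)%N.
pose c' : 'X_{1..n} := [multinom if N <= c j then M + b j else e * c j | j < n]%N.
exists k', c'; split=> [G|].
  have k'_le j : (k' j <= c' j)%N = (N <= c j)%N.
    rewrite mnmE /k'; case: (leqP N (c j)) => [_|lt_cN]; first by rewrite leq_addr.
    by rewrite mulc leq_add2l leqNgt lt_cN.
  have le_iff : (expo_set k' G <= c')%MM <-> (expo_set kN G <= c)%MM.
    by split=> /expo_set_le le_c; apply/expo_set_le => j /le_c; rewrite k'_le.
  split=> [[/le_iff le_c pA]|[le_c Ac]]; (split; first by [|apply/le_iff]).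
    (* On G the vector c' - k' is zero except at j0, where some factor has exponent below g; the gap
       makes that exponent zero. *)
    have [u0 [Au0 le_u0 u0G]] : exists u, [/\ A u, (u <= c' - expo_set k' G)%MM &
        forall j, j \in G -> u j = 0%N].
      have vG j : j \in G -> (c' - expo_set k' G)%MM j = b j.
        move/expo_set_le: le_c => le_c jG; have := le_c j jG.
        by rewrite mnmBE !mnmE jG /k' /kN => ->; rewrite addKn.
      have [u [Au le_u u_j0]] : exists u, [/\ A u, (u <= c' - expo_set k' G)%MM &
          j0 \in G -> (u j0 < g)%N].
        have [j0G|_] := boolP (j0 \in G); last first.
          move: e_gt0 pA; case: (e) => // e' _ [u [u2 [Au _ le_u]]].
          by exists u; split=> //; apply: lepm_trans le_u; apply: lem_addr.
        have [|u [Au le_u lt_u]] := mon_pow_small (j := j0) pA; last by exists u.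
        by rewrite vG // /b eqxx subn1 prednK // muln_gt0 g_gt0.
      have [u0 [Au0 /mnm_lepP le_u0 gap_u0]] := A_gap Au.
      exists u0; split=> // [|j jG].
        by apply: lepm_trans le_u; apply/mnm_lepP.
      have := gap_u0 j; have := le_u0 j; have /mnm_lepP/(_ j) := le_u.
      rewrite vG // /b; case: (j =P j0) => [jj0|_]; last by lia.
      by have := u_j0; rewrite -jj0 => /(_ jG); lia.
    (* A generator of degree at most R fits below c off G by [le_R], and on G it vanishes. *)
    have [u [Au /mnm_lepP le_uu0 le_uR]] := A_generated Au0.
    apply: (A_up Au); apply/mnm_lepP => j; rewrite !(mnmBE, mnmE).
    have := le_uu0 j; case: ifP => [/u0G->|_ _]; first by lia.
    rewrite subn0; apply: leq_trans (le_R j); apply: leq_trans le_uR.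
    by rewrite mdegE (bigD1 j) //= leq_addr.
  (* On G the exponents of u are at most c_j - N < g, hence zero, so e copies of u fit. *)
  have [u [Au /mnm_lepP le_u gap_u]] := A_gap Ac.
  apply: mon_powMn Au _; apply/mnm_lepP => j; rewrite mulmnE mnmBE !mnmE.
  have := le_u j; have := gap_u j; rewrite mnmBE mnmE /kN /M.
  case: ifP => [jG|_] gap_uj le_uj.
    by have := le_cP j; case: (u j) gap_uj le_uj => [//|u']; lia.
  rewrite subn0 in le_uj *.
  have le_cM : (e * c j <= e * mdeg c)%N.
    by rewrite leq_mul // mdegE (bigD1 j) //= leq_addr.
  have : (u j * e <= e * c j)%N by rewrite mulnC leq_mul.
  by case: (leqP N (c j)) => _; lia.
(* After summation the gain is g e - 1 minus the total excess, which is at most g - 1; this leaves g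
   (e - 1). *)
have termE : (\sum_j (c' j + N + (c j - N)) = \sum_j (k' j + c j + b j))%N.
  apply: eq_bigr => j _; rewrite mnmE /k'; case: (leqP N (c j)) => [|lt_cN]; first by lia.
  rewrite mulc /b; case: (j =P j0) => [jj0|]; last by lia.
  by rewrite jj0 leqNgt in le_Nj0 *; rewrite jj0 in lt_cN; rewrite lt_cN in le_Nj0.
have bE : (\sum_j b j = g * e - 1)%N.
  by rewrite (bigD1 j0) //= /b eqxx big1 ?addn0 // => j /negbTE->.
move: termE; rewrite !big_split /= bE -!mdegE sum_const_ord.
have : (g <= g * e)%N by rewrite leq_pmulr.
rewrite mulnBr muln1; move: small.
move: (\sum_(j < n) (c j - N))%N (\sum_(j < n) k' j)%N => sP sk; lia.
Qed.

End Transfer.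

(** * Extremal Betti numbers and the regularity bound *)

Section Main.

Variables (K : fieldType) (n : nat).
Local Notation S := {mpoly K[n]}.
Implicit Types (I : S -> Prop) (F : free_complex K n).

Lemma monomial_ideal_pow I e : monomial_ideal I -> monomial_ideal (ideal_pow I e).
Proof.
move=> monI; exists (mon_pow (monomials_of I) e) => f.
rewrite ideal_powP // monomial_spanP; split=> pf v /pf; first by exists v => //; apply/mnm_lepP.
case=> u; case: e {pf} => // e [u1 [u2 [Iu1 pu2 le_u]]] le_uv.
by exists u1, u2; split=> //; apply: lepm_trans le_uv.
Qed.

(** Hilbert's syzygy bound: for N = 1 a generator of F_i gives a nonzero class by minimality, but
    the Koszul complex has no sets of more than n elements. *)
Lemma resolution_length I F i : monomial_ideal I ->
  minimal_graded_free_resolution F I -> 'I_(rk F i) -> (i <= n)%N.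
Proof.
move=> monI [gF rF minF] a; rewrite leqNgt; apply/negP => lt_ni.
apply: (top_not_acyclic monI gF rF minF (a := a) (ltn0Sn 0)) => [s|c _].
  apply/eqP/negPn/negP => /mcoeff_mulmx_neq0[b [m1 [m2 [/mnmP topE _]]]].
  suff -> : m2 = 0%MM by rewrite minF eqxx.
  by apply/mnmP => j; have := topE j; rewrite mnmDE !mnmE; lia.
have noG (G : {set 'I_n}) : #|G| != i.
  by rewrite neq_ltn (leq_ltn_trans (max_card _)) ?card_ord.
move=> s s_supp _; exists s => [G|G]; first by move/s_supp => [_ /eqP]; rewrite (negbTE (noG G)).
rewrite /boundary big1 => [|j _]; last first.
  apply/eqP; rewrite mulf_eq0; apply/orP; right; apply: contraT => /s_supp[_ /eqP].
  by rewrite (negbTE (noG _)).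
by apply/eqP; apply: contraT => /s_supp[_ /eqP]; rewrite (negbTE (noG _)).
Qed.

(* Take i maximal with a generator of degree i + R: all generators of F_(i+1)
   then have degree at most i + R, hence by minimality their images do not
   involve the generators of degree i + R of F_i. *)
Lemma extremal_not_acyclic I F R : monomial_ideal I ->
  minimal_graded_free_resolution F I ->
  (exists i (a : 'I_(rk F i)), shift a = (i + R)%N) ->
  (forall i (a : 'I_(rk F i)), (shift a <= i + R)%N) ->
  exists i, forall N, (0 < N)%N ->
    ~ (forall c : 'X_{1..n}, (mdeg c + n = i + R + n * N)%N ->
         acyclic K (koszul_face (fun=> N) I c) i).
Proof.
move=> monI resF [i0 [a0 shift_a0]] le_shift; have [gF rF minF] := resF.
pose attained i := [exists a : 'I_(rk F i), shift a == (i + R)%N].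
have ex_att : exists i, attained i by exists i0; apply/existsP; exists a0; rewrite shift_a0.
have att_le i : attained i -> (i <= n)%N.
  by move=> /existsP[a _]; apply: resolution_length resF a.
case: (ex_maxnP ex_att att_le) => i /existsP[a /eqP shift_a] max_i.
exists i => N N_gt0 acI.
apply: (top_not_acyclic monI gF rF minF (a := a) N_gt0) => [s|c dc]; last first.
  by apply: acI; rewrite dc shift_a -[X in (_ + X)%N]muln1 -addnA -mulnDr addn1 prednK.
apply/eqP/negPn/negP => /mcoeff_mulmx_neq0[b [m1 [m2 [_ _ nz]]]].
have [|le_ab /dhomogP hom_ba] := proj2 gF i b a.
  by apply: contraNneq nz => ->; rewrite mcoeff0.
have ltb : (shift b < i.+1 + R)%N.
  rewrite ltn_neqAle le_shift andbT; apply/negP => /eqP shift_b.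
  have /max_i : attained i.+1 by apply/existsP; exists b; apply/eqP.
  by rewrite ltnn.
have : mdeg m2 = (shift b - shift a)%N by apply: hom_ba; rewrite mcoeff_msupp.
rewrite (_ : (_ - _)%N = 0%N); last by lia.
by move=> /eqP; rewrite mdeg_eq0 => /eqP m2E; rewrite m2E minF eqxx in nz.
Qed.

End Main.

Theorem theorem4p5 (K : fieldType) (n : nat) (I : {mpoly K[n]} -> Prop)
    (I_monomial : monomial_ideal I)
    (I_proper : is_proper I)
    (I_nonzero : is_nonzero I)
    (I_closed : integrally_closed I)
    (m : nat) (m_ge1 : (1 <= m)%N)
    (g : nat) (gammaI : is_gamma I g)
    (r rm : int) (regI : is_reg I r) (regIm : is_reg (ideal_pow I m) rm) :
  r + g%:Z * (m%:Z - 1) <= rm.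
Proof.
have betti_shift (F : free_complex K n) i (a : 'I_(rk F i)) :
    betti F i (shift a) != 0%N.
  by rewrite -lt0n; apply/card_gt0P; exists a; rewrite inE.
have [F [resF [i0 [j0 [betti0 rE]]] le_r]] := regI.
have [F' [[gF' rF' _] _ le_rm]] := regIm.
have le_shift i (a : 'I_(rk F i)) : (shift a)%:Z - i%:Z <= r.
  exact/le_r/betti_shift.
have [gF rF minF] := resF.
have g_gt0 : (0 < g)%N by have [A [_ [u [j [_ ? ->]]] _]] := gammaI.
have gen_deg v : monomials_of I v ->
    exists u, [/\ monomials_of I u, (u <= v)%MM & (mdeg u)%:Z <= r].
  move=> /(generator_degree I_monomial gF rF)[u [a [Iu le_uv uE]]].
  by exists u; split=> //; rewrite uE; have := le_shift 0 a; rewrite subr0.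
(* A proper ideal has no generator of degree 0. Positivity lets r be replaced by a natural number
   R. *)
have r_gt0 : 0 < r.
  have [f If nz_f] := I_nonzero.
  have /gen_deg[u [Iu _]] : monomials_of I (mlead f).
    by have /(monomial_idealP _ I_monomial) := If; apply; rewrite mleadc_eq0.
  have : mdeg u != 0%N.
    by rewrite mdeg_eq0; apply/negP => /eqP u0; apply: I_proper; rewrite -mpolyX0 -u0.
  by lia.
have [R rR] : exists R : nat, r = R%:Z by exists `|r|%N; lia.
have [|i a|i not_acyclic] := @extremal_not_acyclic K n I F R I_monomial resF.
- move: betti0; rewrite -lt0n => /card_gt0P[a]; rewrite inE => /eqP shift_a.
  by exists i0, a; lia.
- by have := le_shift i a; lia.
have [//|lt_rm] := lerP (r + g%:Z * (m%:Z - 1)) rm; exfalso.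
(* This is the least N allowed by [transfer_small]. *)
pose N := (R + g + n + 1)%N.
apply: (not_acyclic N) => [|c dc]; first by rewrite /N; lia.
have A_up u v : monomials_of I u -> (u <= v)%MM -> monomials_of I v.
  exact: monomials_ofS.
have A_gap v := gap_generator (v := v) gammaI.
have A_gen v : monomials_of I v ->
    exists u, [/\ monomials_of I u, (u <= v)%MM & (mdeg u <= R)%N].
  by move=> /gen_deg[u [Iu le_uv le_u]]; exists u; split=> //; lia.
have A_root v := integrally_closed_mon_pow (v := v) I_monomial I_closed m_ge1.
have [k' [c' [faceE le_deg]]] : exists k' c',
    (forall G : {set 'I_n},
       (expo_set k' G <= c')%MM /\ mon_pow (monomials_of I) m (c' - expo_set k' G)
       <-> koszul_face (fun=> N) I c G) /\
    (mdeg c + \sum_j k' j + g * (m - 1) <= mdeg c' + n * N)%N.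
  have [le_g|lt_g] := leqP g (\sum_j (c j - N)); first exact: transfer_large.
  apply: (transfer_small (R := R)) => //; rewrite /N; lia.
apply: (eq_acyclic (Face := koszul_face k' (ideal_pow I m) c')) => [G|].
  by rewrite -faceE; split=> -[le_c /(ideal_powXP _ _ I_monomial)].
(* If [rm] were smaller than claimed, every generator of F'_i would have degree below i + R + g (m -
   1), which [le_deg] bounds by the degree of c' plus n minus the sum of the k'_j. *)
apply: (high_degree_acyclic (monomial_ideal_pow m I_monomial) gF' rF') => a.
have := le_rm i (shift a) (betti_shift F' i a).
have mE : m%:Z - 1 = (m - 1)%N%:Z by lia.
have rE' : r + g%:Z * (m%:Z - 1) = (R + g * (m - 1))%N%:Z by rewrite mE rR PoszD PoszM.
by move: lt_rm; rewrite rE'; lia.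
Qed.
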